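(* There is a polynomial-time algorithm that, given a finite set $\mathcal{C}$ of alternatives, an alternative $c\in\mathcal{C}$ and a profile $P_{poset}$ of partial orders on $\mathcal{C}$, checks whether or not $c$ is a necessary winner for $P_{poset}$ with respect to Bucklin.
   Context: Let $\mathcal{C}$ be a finite set of $m$ alternatives; $m$ is part of the input and not bounded, and votes are unweighted. A (complete) profile is a finite list $P=(V_1,\dots,V_n)$ of linear orders on $\mathcal{C}$. A voting rule $r$ maps each profile to a nonempty subset of $\mathcal{C}$ (the winners). A partial order is a reflexive, transitive, antisymmetric relation; a linear order $V$ extends a partial order $O$ if $O\subseteq V$. A profile $P=(V_1,\dots,V_n)$ of linear orders extends a profile $P_{poset}=(O_1,\dots,O_n)$ of partial orders if each $V_i$ extends $O_i$. An alternative $c$ is a necessary winner for $P_{poset}$ with respect to $r$ if every extension $P$ of $P_{poset}$ satisfies $r(P)=\{c\}$. Bucklin: the Bucklin score of an alternative is the smallest number $k$ such that more than half of the votes rank it among the top $k$ alternatives. The winners are all alternatives with the smallest Bucklin score (no further tie-breaking). *)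

(* Defs.v *)
From mathcomp Require Import all_boot all_order all_algebra.

Set Implicit Arguments.
Unset Strict Implicit.
Unset Printing Implicit Defensive.

(* Bits and the blank symbol [None]; restricting machines to this tape alphabet
   costs only constant factors in time. *)
Definition symbol : Type := option bool.

Inductive move := Left | Stay | Right.

(* A machine has [ntapes.+1] tapes, tape [ord0] holding the input. A state [q]
   is halting, with answer [b], when [verdict q = Some b]. *)
Record machine := Machine {
  ntapes : nat;
  state : finType;
  start : state;
  verdict : state -> option bool;
  trans : state -> {ffun 'I_ntapes.+1 -> symbol} ->
          state * ('I_ntapes.+1 -> symbol * move)
}.

Record config (M : machine) := Config {
  cstate : state M;
  head : 'I_(ntapes M).+1 -> nat;
  cell : 'I_(ntapes M).+1 -> nat -> symbol
}.

(* Tapes are infinite to the right only: moving left from cell 0 has no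
   effect. *)
Definition move_head (d : move) (p : nat) : nat :=
  match d with Left => p.-1 | Stay => p | Right => p.+1 end.

Definition step (M : machine) (k : config M) : config M :=
  if verdict (cstate k) is Some _ then k else
  let: (q, act) := trans (cstate k) [ffun i => cell k i (head k i)] in
  Config q
    (fun i => move_head (act i).2 (head k i))
    (fun i j => if j == head k i then (act i).1 else cell k i j).

Definition init (M : machine) (x : seq bool) : config M :=
  Config (start M) (fun=> 0)
    (fun i j => if i == ord0 then onth x j else None).

Definition answers_within (M : machine) (x : seq bool) (t : nat) (b : bool)
    : Prop :=
  verdict (cstate (iter t (@step M) (init M x))) = Some b.

Section Orders.
Variable C : finType.

(* [r a b] reads: [a] is ranked at least as high as [b]. *)
Definition partial_order (r : rel C) : Prop :=
  [/\ reflexive r, transitive r & antisymmetric r].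

Definition linear_order (r : rel C) : Prop := partial_order r /\ total r.

(* The position of [a], the top alternative having position 1. *)
Definition rank (r : rel C) (a : C) : nat := #|[set b | r b a]|.

End Orders.

Definition profile (C : finType) (n : nat) : Type := 'I_n -> rel C.

Definition voting_rule : Type :=
  forall (C : finType) (n : nat), profile C n -> {set C}.

Definition necessary_winner (r : voting_rule) (C : finType) (n : nat)
    (O : profile C n) (c : C) : Prop :=
  forall V : profile C n,
    (forall i, linear_order (V i)) ->
    (forall i, subrel (O i) (V i)) ->
    r C n V = [set c].

Definition majority_top (C : finType) (n : nat) (V : profile C n) (a : C)
    (k : nat) : bool :=
  n < 2 * #|[set i : 'I_n | rank (V i) a <= k]|.

(* The least [k <= #|C|] such that a majority ranks [a] among the top [k]; the
   seed [ord_max] of the minimisation qualifies as soon as [0 < n], so that the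
   value is meaningful for nonempty profiles. *)
Definition bucklin_score (C : finType) (n : nat) (V : profile C n) (a : C)
    : nat :=
  [arg min_(k < @ord_max #|C| | majority_top V a k) (k : nat)].

Definition bucklin : voting_rule := fun C n V =>
  [set a | [forall b, bucklin_score V a <= bucklin_score V b]].

(* The number of alternatives in unary, closed by a 0; the characteristic vector
   of [c]; then, vote after vote, the matrix of the partial order. The number of
   votes is determined by the length of the string. *)
Definition encode (C : finType) (n : nat) (O : profile C n) (c : C) : seq bool :=
  nseq #|C| true ++ false ::
  [seq a == c | a <- enum C] ++
  flatten [seq [seq O i a b | a <- enum C, b <- enum C] | i <- enum 'I_n].

(* Main.v *)
Require Import Defs.
From mathcomp Require Import all_boot all_order all_algebra.
From mathcomp Require Import zify.

(** A rival [d] prevents [c] from being the unique Bucklin winner exactly when,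
    for some level [k], a majority of the votes can rank [d] among the top [k]
    while no majority ranks [c] among the top [k - 1]. In a single vote the two
    wishes "[d] in the top [k]" and "[c] not in the top [k - 1]" are feasible
    separately iff, respectively, at most [k] alternatives are above [d] and at
    least [k - 1] are not below [c]; they are feasible together iff moreover [c]
    is not above [d], since then the alternatives above [d] and those below [c]
    are disjoint and can be moved to both ends. In the votes where only one of
    the two feasible wishes can be granted the choice is free, so that the whole
    profile is governed by three comparisons between numbers of votes.

    These numbers are obtained by reading the matrices once for each pair
    [(d, k)]. The machine doing so is compiled from a small structured language
    whose programs act on a fixed number of tapes. *)

Set Implicit Arguments.
Unset Strict Implicit.
Unset Printing Implicit Defensive.

(** * Extending votes in favor of a rival *)

Section Extension.
Variables (C : finType) (r : rel C).
Hypothesis r_po : partial_order r.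

Lemma rank_le_card (V : rel C) a : rank V a <= #|C|.
Proof. exact: max_card. Qed.

Lemma rank_lt a b : r a b -> a != b -> rank r a < rank r b.
Proof.
case: r_po => refl_r trans_r anti_r rab neq_ab.
apply/proper_card/properP; split.
  by apply/subsetP => x; rewrite !inE => rxa; apply: trans_r rab.
exists b; rewrite !inE ?refl_r //; apply: contra neq_ab => rba.
by apply/eqP/anti_r; rewrite rab.
Qed.

(* The linear extension comparing first the level [f], then the number of
   alternatives above, and breaking the remaining ties by [enum_rank]. *)
Definition linear_key (f : C -> nat) (a : C) : nat :=
  (f a * #|C|.+1 + rank r a) * #|C| + enum_rank a.

Definition linearize (f : C -> nat) : rel C :=
  fun a b => linear_key f a <= linear_key f b.

(** Modulo [#|C|] the key is [enum_rank], so distinct alternatives never tie. *)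
Lemma linear_key_inj f : injective (linear_key f).
Proof.
move=> a b eq_ab; apply/enum_rank_inj/val_inj => /=.
have := congr1 (modn^~ #|C|) eq_ab.
by rewrite /linear_key !modnMDl !modn_small.
Qed.

(** [enum_rank a] is below [#|C|], so it cannot outweigh a difference of 1 in the leading part. *)
Lemma linear_key_lt f a b :
    f a * #|C|.+1 + rank r a < f b * #|C|.+1 + rank r b ->
  linear_key f a < linear_key f b.
Proof.
move=> lt_ab; have lt_a := ltn_ord (enum_rank a).
apply: (@leq_trans ((f a * #|C|.+1 + rank r a).+1 * #|C|)).
  by rewrite mulSnr ltn_add2l.
by apply: leq_trans (leq_addr _ _); rewrite leq_mul2r lt_ab orbT.
Qed.

Lemma linearize_linear f : linear_order (linearize f).
Proof.
split; last by move=> a b; apply: leq_total.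
split; [by move=> a; apply: leqnn | by move=> b a c; apply: leq_trans |].
by move=> a b; rewrite -eqn_leq => /eqP/linear_key_inj.
Qed.

(** The rank strictly increases along [r], so levels that never decrease along [r] leave the order
    of comparable alternatives intact. *)
Lemma linearize_sub f : {homo f : a b / r a b >-> a <= b} ->
  subrel r (linearize f).
Proof.
move=> mono_f a b rab; have [->|neq_ab] := eqVneq a b; first exact: leqnn.
apply/ltnW/linear_key_lt.
by rewrite -addnS leq_add ?rank_lt // leq_mul2r mono_f ?orbT.
Qed.

(** A rank is at most [#|C|], less than the weight [#|C|.+1] of one level. *)
Lemma linearize_lt f a b : f a < f b -> ~~ linearize f b a.
Proof.
move=> lt_ab; rewrite -ltnNge; apply: linear_key_lt.
apply: (@leq_trans ((f a).+1 * #|C|.+1)).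
  by rewrite mulSnr ltn_add2l ltnS rank_le_card.
by apply: leq_trans (leq_addr _ _); rewrite leq_mul2r lt_ab orbT.
Qed.

(* [u] asks for [d] to be as high, [w] for [c] to be as low as possible. *)
Definition favor (c d : C) (u w : bool) : rel C :=
  linearize (fun a => (u && ~~ r a d) + (w && r c a)).

Lemma favor_sub c d u w : subrel r (favor c d u w).
Proof.
case: r_po => _ trans_r _; apply: linearize_sub => a b rab; apply: leq_add.
  by case: u => //; case: (boolP (r b d)) => [/(trans_r _ _ _ rab)->|_];
    case: (r a d).
by case: w => //; case: (boolP (r c a)) => // /trans_r->.
Qed.

(** [d] is at level 0 by compatibility, and each alternative not above [d] in [r] has a positive
    level, hence comes after [d]. *)
Lemma favor_rank_rival c d u w : (u && w -> ~~ r c d) -> u ->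
  rank (favor c d u w) d <= rank r d.
Proof.
case: r_po => refl_r _ _ compat u_true; rewrite u_true in compat *.
apply/subset_leq_card/subsetP => b; rewrite !inE; apply: contraTT => nbd.
apply: linearize_lt; rewrite /= refl_r nbd /=.
by case: w compat => // /(_ isT)/negPf->.
Qed.

(** [c] is at level 2 with [u] and at level 1 without; an alternative not below [c] lacks the second
    summand and so precedes [c]. The successor counts [c] itself. *)
Lemma favor_rank_low c d u w : (u && w -> ~~ r c d) -> w ->
  #|[set b | ~~ r c b]|.+1 <= rank (favor c d u w) c.
Proof.
case: r_po => refl_r _ _ compat w_true; rewrite w_true andbT in compat *.
have -> : #|[set b | ~~ r c b]|.+1 = #|c |: [set b | ~~ r c b]|.
  by rewrite cardsU1 inE refl_r.
apply/subset_leq_card/subsetP => b; rewrite !inE.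
case/orP=> [/eqP->|ncb]; first exact: leqnn.
apply/ltnW; rewrite ltnNge; apply: linearize_lt; rewrite refl_r (negPf ncb).
by case: u compat => //= /(_ isT)->; case: (r b d).
Qed.

Variable V : rel C.
Hypotheses (V_lin : linear_order V) (V_ext : subrel r V).

Lemma rank_ext_ge a : rank r a <= rank V a.
Proof.
by apply/subset_leq_card/subsetP => b; rewrite !inE; apply: V_ext.
Qed.

(** By antisymmetry of [V], an alternative other than [a] that [V] puts above [a] is not below [a]
    in [r]. *)
Lemma rank_ext_le a : rank V a <= #|[set b | ~~ r a b]|.+1.
Proof.
case: V_lin r_po => -[_ _ anti_V] _ [refl_r _ _].
have -> : #|[set b | ~~ r a b]|.+1 = #|a |: [set b | ~~ r a b]|.
  by rewrite cardsU1 inE refl_r.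
apply/subset_leq_card/subsetP => b; rewrite !inE => Vba.
rewrite -implyNb; apply/implyP; apply: contra => rab.
by apply/eqP/anti_V; rewrite Vba V_ext.
Qed.

End Extension.

Lemma rank_linear_lt (C : finType) (V : rel C) a b : linear_order V ->
  V a b -> a != b -> rank V a < rank V b.
Proof. by case=> V_po _; apply: rank_lt. Qed.

(** * Bucklin scores as majority thresholds *)

Section Bucklin.
Variables (C : finType) (n : nat).
Hypothesis n_gt0 : 0 < n.

Lemma majority_top_mono (V : profile C n) a k k' :
  k <= k' -> majority_top V a k -> majority_top V a k'.
Proof.
move=> le_kk'; rewrite /majority_top => /leq_trans; apply.
rewrite leq_mul2l; apply/subset_leq_card/subsetP => i; rewrite !inE.
by move/leq_trans; apply.
Qed.

(** Trades the minimisation for a threshold test: the seed qualifies since [n] is positive,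
    qualifying levels are upward closed, and a [k] beyond [#|C|] bounds every score. *)
Lemma bucklin_score_le (V : profile C n) a k :
  (bucklin_score V a <= k) = majority_top V a k.
Proof.
have top : majority_top V a (@ord_max #|C|).
  have -> : majority_top V a (@ord_max #|C|) = (n < 2 * #|[set: 'I_n]|).
    by congr (_ < 2 * _); apply: eq_card => i; rewrite !inE rank_le_card.
  by rewrite cardsT card_ord mul2n -addnn -addn1 leq_add2l.
rewrite /bucklin_score; case: arg_minnP => // j maj_j min_j.
apply/idP/idP => [le_jk|maj_k]; first exact: majority_top_mono maj_j.
have [lt_kC|le_Ck] := ltnP k #|C|.+1; first exact: (min_j (Ordinal lt_kC)).
by apply: leq_trans (ltnW le_Ck); rewrite -ltnS.
Qed.

Lemma bucklin_single (V : profile C n) c : bucklin V = [set c] <->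
  forall d, d != c -> bucklin_score V c < bucklin_score V d.
Proof.
pose s := bucklin_score V.
have winE a : (a \in bucklin V) = [forall b, s a <= s b] by rewrite inE.
split=> [win d neq_dc|best].
  have /forallP min_c : [forall b, s c <= s b] by rewrite -winE win set11.
  rewrite ltnNge; apply: contra neq_dc => le_dc.
  rewrite -in_set1 -win winE; apply/forallP => b.
  exact: leq_trans le_dc (min_c b).
apply/setP => a; rewrite winE inE; apply/forallP/eqP => [min_a|->{a} b].
  by apply/eqP/contraT => /best; rewrite ltnNge -/s min_a.
by have [->|/best/ltnW] := eqVneq b c.
Qed.

End Bucklin.

(** * Granting the two wishes vote by vote *)

Lemma card_set_sum (I : finType) (p : pred I) :
  #|[set i | p i]| = \sum_i (p i : nat).
Proof.
by rewrite -sum1dep_card big_mkcond; apply: eq_bigr => i _; case: (p i).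
Qed.

Lemma subset_with_card (I : finType) (A : {set I}) j : j <= #|A| ->
  exists2 S : {set I}, S \subset A & #|S| = j.
Proof.
move=> le_jA; exists [set x in take j (enum A)].
  by apply/subsetP => x; rewrite inE => /mem_take; rewrite mem_enum.
rewrite cardsE (card_uniqP _) ?take_uniq ?enum_uniq //.
by rewrite size_takel // -cardE.
Qed.

(** Both wishes are granted wherever possible. In the votes where they conflict, those satisfying
    [p], [q] and [e], a set [S] serves [u] and the rest serves [w]; only the size of [S] matters. *)
Lemma choose_votes (I : finType) (p q e : pred I) :
    #|[set i | ~~ p i]| < #|[set i | p i]| ->
    #|[set i | ~~ q i]| <= #|[set i | q i]| ->
    #|[set i | ~~ p i && ~~ q i]| < #|[set i | [&& p i, q i & ~~ e i]]| ->
  exists u w : pred I,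
    [/\ subpred u p, subpred w q, forall i, u i && w i -> ~~ e i,
        #|I| < 2 * #|[set i | u i]| & 2 * #|[set i | ~~ w i]| <= #|I|].
Proof.
set P' := #|_|; set P := #|_|; set Q' := #|_|; set Q := #|_|.
set T := #|_|; set G := #|_| => lt_P le_Q lt_TG.
pose D := #|[set i | p i && ~~ q i]|; pose A := [set i | [&& p i, q i & e i]].
have eP : P = G + D + #|A|.
  rewrite /P /G /D /A !card_set_sum -!big_split; apply: eq_bigr => i _.
  by case: (p i) (q i) (e i) => [] [] [].
have eQ' : Q' = T + D.
  rewrite /Q' /T /D !card_set_sum -!big_split; apply: eq_bigr => i _.
  by case: (p i) (q i) => [] [].
have eI : #|I| = P + P' /\ #|I| = Q + Q'.
  rewrite -cardsT /P /P' /Q /Q' !card_set_sum -!big_split.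
  by split; apply: eq_bigr => i _ /=; [case: (p i) | case: (q i)].
(* [S] is just large enough to give [u] a strict majority. Then [T < G] leaves at most half of the
   votes outside [w]; if the difference truncates to 0, [le_Q] gives this bound. *)
have [|S /subsetP sSA cardS] := @subset_with_card _ A (#|I|./2.+1 - (G + D)).
  by lia.
have S_pqe i : i \in S -> [&& p i, q i & e i] by move/sSA; rewrite inE.
exists (fun i => p i && ~~ (q i && e i) || (i \in S)).
exists (fun i => q i && (i \notin S)).
have cardSE : #|S| = \sum_i ((i \in S) : nat).
  by rewrite -sum1_card big_mkcond; apply: eq_bigr => i _; case: (i \in S).
split.
- by move=> i /orP[/andP[]|/S_pqe/andP[]].
- by move=> i /andP[].
- move=> i; case: (boolP (i \in S)) => [_|_]; first by rewrite andbF andbF.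
  by rewrite orbF andbT => /andP[/andP[_] /[swap] ->].
- have -> : #|[set i | p i && ~~ (q i && e i) || (i \in S)]| = G + D + #|S|.
    rewrite cardSE /G /D !card_set_sum -!big_split; apply: eq_bigr => i _.
    by case: (boolP (i \in S)) => [/S_pqe|_];
      case: (p i) (q i) (e i) => [] [] [].
  by lia.
have -> : #|[set i | ~~ (q i && (i \notin S))]| = T + D + #|S|.
  rewrite cardSE /T /D !card_set_sum -!big_split; apply: eq_bigr => i _.
  by case: (boolP (i \in S)) => [/S_pqe|_]; case: (p i) (q i) (e i) => [] [] [].
by lia.
Qed.

(** * Necessary winners through three comparisons *)

Section Characterization.
Variables (C : finType) (n : nat) (O : profile C n) (c : C).
Hypotheses (n_gt0 : 0 < n) (O_po : forall i, partial_order (O i)).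

(** [p i] is the feasibility of [d] within the top [k] in vote [i], [q i] that of [c] at position
    [k] or lower. The comparisons are the hypotheses of [choose_votes], with [O i c d] as the
    conflict. *)
Definition can_beat (d : C) (k : nat) : bool :=
  let p i := rank (O i) d <= k in
  let q i := k <= #|[set b | ~~ O i c b]|.+1 in
  [&& #|[set i | ~~ p i]| < #|[set i | p i]|,
      #|[set i | ~~ q i]| <= #|[set i | q i]| &
      #|[set i | ~~ p i && ~~ q i]| < #|[set i | [&& p i, q i & ~~ O i c d]]|].

(** If the comparisons hold, [choose_votes] and [favor] build an extension in which [d] scores at
    most [k] and [c] at least [k]. Conversely, if [d] scores no more than [c] in some extension, the
    comparisons hold with the score of [d] as [k]. *)
Lemma can_beatP : necessary_winner bucklin O c <->
  forall d k, d != c -> 0 < k <= #|C| -> ~~ can_beat d k.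
Proof.
split=> [nec d k neq_dc /andP[k_gt0 _]|nobeat V V_lin V_ext].
  apply/negP => /and3P[lt_P le_Q lt_TG].
  have [u [w [up wq uw maj_u min_w]]] := choose_votes lt_P le_Q lt_TG.
  pose V : profile C n := fun i => favor (O i) c d (u i) (w i).
  have /bucklin_single/(_ d neq_dc) : bucklin V = [set c].
    apply: nec => i; first exact: linearize_linear.
    exact: favor_sub.
  rewrite ltnNge => /negP[]; apply: (@leq_trans k).
    rewrite bucklin_score_le // /majority_top.
    rewrite card_ord in maj_u; apply: leq_trans maj_u _.
    rewrite leq_mul2l; apply/subset_leq_card/subsetP => i; rewrite !inE => ui.
    by apply: leq_trans (up i ui); apply: favor_rank_rival => //; apply: uw.
  rewrite -(prednK k_gt0) ltnNge bucklin_score_le // /majority_top -leqNgt.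
  rewrite card_ord in min_w; apply: leq_trans min_w.
  rewrite leq_mul2l; apply/subset_leq_card/subsetP => i; rewrite !inE.
  apply: contraL => wi; rewrite -ltnNge (prednK k_gt0).
  apply: leq_trans (wq i wi) _; apply: favor_rank_low => //; exact: uw.
apply/bucklin_single => d neq_dc; rewrite ltnNge; apply/negP => le_dc.
set k := bucklin_score V d in le_dc.
have maj_d : majority_top V d k by rewrite -bucklin_score_le.
(* By reflexivity no rank is 0, so no majority reaches level 0. *)
have k_gt0 : 0 < k.
  rewrite lt0n; apply: contraTneq maj_d => ->; rewrite /majority_top.
  rewrite (_ : #|_| = 0) //; apply: eq_card0 => i; rewrite !inE leqn0 cards_eq0.
  apply/negP => /eqP/setP/(_ d); rewrite !inE.
  by case: (V_lin i) => -[refl_V _ _] _; rewrite refl_V.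
have maj_c : ~~ majority_top V c k.-1.
  by rewrite -bucklin_score_le // -ltnNge (prednK k_gt0).
have le_kC : k <= #|C| by rewrite -ltnS ltn_ord.
have /negP[] := nobeat d k neq_dc (introT andP (conj k_gt0 le_kC)).
move: maj_d maj_c; rewrite /majority_top -leqNgt.
pose p := fun i => rank (O i) d <= k.
pose q := fun i => k <= #|[set b | ~~ O i c b]|.+1.
pose a i := rank (V i) d <= k; pose b i := rank (V i) c <= k.-1.
have ap i : a i -> p i by apply: leq_trans; exact: rank_ext_ge.
have bq i : ~~ b i -> q i.
  rewrite /b -ltnNge (prednK k_gt0) => /leq_trans; apply; exact: rank_ext_le.
(* If [c] were above [d] in [O i], then [d] in the top [k] would push [c] into the top [k.-1]. *)
have abe i : a i -> ~~ b i -> ~~ O i c d.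
  move=> ai; apply: contra => Ocd; rewrite /b -ltnS (prednK k_gt0).
  apply: leq_trans ai; apply: rank_linear_lt => //; last by rewrite eq_sym.
  exact: V_ext.
rewrite -[[set i | rank (V i) d <= k]]/[set i | a i].
rewrite -[[set i | rank (V i) c <= k.-1]]/[set i | b i] => maj_a min_b.
have eI (x : pred 'I_n) : #|[set i | x i]| + #|[set i | ~~ x i]| = n.
  rewrite -[RHS]card_ord -cardsT !card_set_sum -big_split.
  apply: eq_bigr => i _.
  by case: (x i).
have le_ap : #|[set i | a i]| <= #|[set i | p i]|.
  by apply/subset_leq_card/subsetP => i; rewrite !inE; apply: ap.
have le_qb : #|[set i | ~~ q i]| <= #|[set i | b i]|.
  apply/subset_leq_card/subsetP => i; rewrite !inE; apply: contraR.
  exact: bq.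
(* This holds vote by vote: [a] without [b] forces [q] and excludes the conflict, while a vote with
   neither [p] nor [q] satisfies [b] but not [a]. Since [a] has a majority and [b] has none, the
   third comparison becomes strict. *)
have le_TG : #|[set i | a i]| + #|[set i | ~~ p i && ~~ q i]| <=
    #|[set i | b i]| + #|[set i | [&& p i, q i & ~~ O i c d]]|.
  rewrite !card_set_sum -!big_split; apply: leq_sum => i _ /=.
  move: (ap i) (bq i) (abe i).
  case: (a i) (b i) (p i) (q i) (O i c d) => [] [] [] [] [] //= ai bi abi;
    by [move: (ai isT) | move: (bi isT) | move: (abi isT isT)].
have := eI p; have := eI q.
move=> eq_q eq_p.
have [lt_p le_q] : #|[set i | ~~ p i]| < #|[set i | p i]| /\
    #|[set i | ~~ q i]| <= #|[set i | q i]| by lia.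
have lt_TG : #|[set i | ~~ p i && ~~ q i]| <
    #|[set i | [&& p i, q i & ~~ O i c d]]| by lia.
exact/and3P.
Qed.

End Characterization.

(** * Structured programs on tapes *)

(** A zipper: the cells left of the head, nearest first, then the cells from the head on, with
    blanks beyond. *)
Definition tape : Type := seq symbol * seq symbol.

Definition blank : tape := ([::], [::]).

(** Never creates a trailing blank, so that tapes can be compared by plain equality. *)
Definition cons_symbol (x : symbol) (r : seq symbol) : seq symbol :=
  match x, r with None, [::] => [::] | _, _ => x :: r end.

Definition cur (t : tape) : symbol := head None t.2.

Definition write (x : symbol) (t : tape) : tape :=
  (t.1, cons_symbol x (behead t.2)).

Definition shift (d : move) (t : tape) : tape :=
  match d with
  | Left => if t.1 is x :: l then (l, cons_symbol x t.2) else t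
  | Stay => t
  | Right => (cur t :: t.1, behead t.2)
  end.

Definition contents (t : tape) : seq symbol := catrev t.1 t.2.

Lemma nth_cons_symbol x r j :
  nth None (cons_symbol x r) j = nth None (x :: r) j.
Proof. by case: x r => [b|] [|y r] //=; case: j => // -[]. Qed.

Lemma nth_contents t j : nth None (contents t) j =
  if j < size t.1 then nth None (rev t.1) j else nth None t.2 (j - size t.1).
Proof. by rewrite /contents catrevE nth_cat size_rev. Qed.

Lemma nth_contents_cur t : nth None (contents t) (size t.1) = cur t.
Proof. by rewrite nth_contents ltnn subnn nth0. Qed.

Lemma nth_contents_write x t j : nth None (contents (write x t)) j =
  if j == size t.1 then x else nth None (contents t) j.
Proof.
rewrite !nth_contents /=; case: ltngtP => // lt_j.
  by rewrite nth_cons_symbol -(subnKC lt_j) addSnnS addKn /= nth_behead.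
by rewrite lt_j subnn nth_cons_symbol.
Qed.

Lemma nth_contents_shift d t j :
  nth None (contents (shift d t)) j = nth None (contents t) j.
Proof.
case: d t => [] [l r] //=.
  case: l => [|x l] //=; rewrite /contents /= !catrevE !nth_cat nth_cons_symbol.
  by case: ifP.
rewrite /contents /= !catrevE !nth_cat; case: ltnP => //.
by case: r => // _; rewrite /= nth_nil; case: (j - _) => //= n; rewrite nth_nil.
Qed.

Lemma size_shift d t : size (shift d t).1 = move_head d (size t.1).
Proof. by case: d t => [] [[|x l] r]. Qed.

Fixpoint upd (s : seq tape) (i : nat) (t : tape) : seq tape :=
  match s, i with
  | [::], _ => [::]
  | _ :: s', 0 => t :: s'
  | u :: s', i'.+1 => u :: upd s' i' t
  end.

Lemma size_upd s i t : size (upd s i t) = size s.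
Proof. by elim: s i => [|u s IHs] [|i] //=; rewrite IHs. Qed.

Lemma nth_upd s i t j : j < size s ->
  nth blank (upd s i t) j = if j == i then t else nth blank s j.
Proof. by elim: s i j => [|u s IHs] [|i] [|j] //= /IHs->. Qed.

(** * Syntax and semantics of programs *)

Inductive cmd :=
| Put (i : nat) (x : symbol)
| Go (i : nat) (d : move)
| Seq (c1 c2 : cmd)
| If (i : nat) (P : pred symbol) (c1 c2 : cmd)
| While (i : nat) (P : pred symbol) (c : cmd).

(* Program points, which become the states of the compiled machine; for [If] and
   [While], [None] is the point where the test is evaluated. *)
Fixpoint point (c : cmd) : finType :=
  match c with
  | Put _ _ | Go _ _ => unit
  | Seq c1 c2 => (point c1 + point c2)%type
  | If _ _ c1 c2 => option (point c1 + point c2)%type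
  | While _ _ c1 => option (point c1)
  end.

Fixpoint entry (c : cmd) : point c :=
  match c return point c with
  | Put _ _ | Go _ _ => tt
  | Seq c1 c2 => inl (entry c1)
  | If _ _ _ _ | While _ _ _ => None
  end.

Definition action : Type := option (nat * (symbol + move)).

Definition act (a : action) (s : seq tape) : seq tape :=
  match a with
  | Some (i, inl x) => upd s i (write x (nth blank s i))
  | Some (i, inr d) => upd s i (shift d (nth blank s i))
  | None => s
  end.

Lemma size_act a s : size (act a s) = size s.
Proof. by case: a => [[i []]|] //= ?; rewrite size_upd. Qed.

(** The result [None] in place of a point is the exit. A sequence goes from the last action of its
    first part straight to the entry of the second, without a step of its own. *)
Fixpoint next (c : cmd) : point c -> seq symbol -> option (point c) * action :=
  match c return point c -> seq symbol -> option (point c) * action with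
  | Put i x => fun _ _ => (None, Some (i, inl x))
  | Go i d => fun _ _ => (None, Some (i, inr d))
  | Seq c1 c2 => fun q rd =>
      match q with
      | inl q1 => let r := next q1 rd in
          (Some (if r.1 is Some q' then inl q' else inr (entry c2)), r.2)
      | inr q2 => let r := next q2 rd in (omap inr r.1, r.2)
      end
  | If i P c1 c2 => fun q rd =>
      match q with
      | None => (Some (Some (if P (nth None rd i) then inl (entry c1)
                             else inr (entry c2))), None)
      | Some (inl q1) => let r := next q1 rd in (omap (Some \o inl) r.1, r.2)
      | Some (inr q2) => let r := next q2 rd in (omap (Some \o inr) r.1, r.2)
      end
  | While i P c1 => fun q rd =>
      match q with
      | None => (if P (nth None rd i) then Some (Some (entry c1)) else None,
                 None)
      | Some q1 => let r := next q1 rd in (Some r.1, r.2)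
      end
  end.

Definition cstep (c : cmd) (x : option (point c) * seq tape) :=
  if x.1 is Some q then
    let r := next q (map cur x.2) in (r.1, act r.2 x.2)
  else x.

(* [t] is only an upper bound on the running time. *)
Definition runs (c : cmd) (s : seq tape) (t : nat) (s' : seq tape) : Prop :=
  exists2 u, u <= t & iter u (@cstep c) (Some (entry c), s) = (None, s').

(** The simulating run is cut off once the simulated one is dead, since [g] may then move on; hence
    only [v <= u]. *)
Lemma iter_simulation (A B : Type) (f : A -> A) (g : B -> B)
    (R : A -> B -> Prop) (live : pred A) :
    (forall a, ~~ live a -> f a = a) ->
    (forall a b, R a b -> live a -> R (f a) (g b)) ->
  forall u a b, R a b -> exists2 v, v <= u & R (iter u f a) (iter v g b).
Proof.
move=> dead step; elim=> [|u IHu] a b Rab; first by exists 0.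
have [la|da] := boolP (live a); last first.
  by exists 0 => //; elim: u.+1 => //= v IHv; rewrite -iterS iterSr dead.
have [v le_vu Rv] := IHu _ _ (step _ _ Rab la).
by exists v.+1; rewrite // !iterSr.
Qed.

(** Runs a subprogram inside a larger program: [h] places its points and sends its exit to the point
    that follows. *)
Lemma runs_embed (c c' : cmd) (h : option (point c) -> option (point c'))
    s t s' :
    (forall q s0, cstep (h (Some q), s0) =
                  (h (cstep (Some q, s0)).1, (cstep (Some q, s0)).2)) ->
    runs c s t s' ->
  exists2 u, u <= t &
    iter u (@cstep c') (h (Some (entry c)), s) = (h None, s').
Proof.
move=> hstep [u le_ut eq_s'].
pose R (x : option (point c) * seq tape) y := y = (h x.1, x.2).
have dead (x : option (point c) * seq tape) : ~~ isSome x.1 -> cstep x = x.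
  by case: x => -[].
have live (x : option (point c) * seq tape) y :
    R x y -> isSome x.1 -> R (cstep x) (cstep y).
  by case: x => -[q|] // s0 -> _; rewrite /= hstep.
have [v le_vu] := iter_simulation dead live u
  (erefl : R (Some (entry c), s) (h (Some (entry c)), s)).
by rewrite eq_s' => eq_v; exists v; first exact: leq_trans le_ut.
Qed.

Lemma runs_le c s t t' s' : runs c s t s' -> t <= t' -> runs c s t' s'.
Proof.
by move=> [u le_ut eq_s'] le_tt'; exists u; rewrite ?(leq_trans le_ut).
Qed.

Lemma runs_put i x s : runs (Put i x) s 1 (upd s i (write x (nth blank s i))).
Proof. by exists 1. Qed.

Lemma runs_go i d s : runs (Go i d) s 1 (upd s i (shift d (nth blank s i))).
Proof. by exists 1. Qed.

Lemma runs_seq c1 c2 s t1 s1 t2 s2 :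
  runs c1 s t1 s1 -> runs c2 s1 t2 s2 -> runs (Seq c1 c2) s (t1 + t2) s2.
Proof.
move=> run1 run2.
have [|u1 le_u1 eq_s1] := @runs_embed c1 (Seq c1 c2)
  (fun o => Some (if o is Some q then inl q else inr (entry c2))) s t1 s1 _
  run1.
  by [].
have [|u2 le_u2 eq_s2] := @runs_embed c2 (Seq c1 c2) (omap inr) s1 t2 s2 _ run2.
  by [].
by exists (u2 + u1); [rewrite addnC leq_add | rewrite iterD eq_s1].
Qed.

Lemma runs_if i (P : pred symbol) c1 c2 s t s' :
  runs (if P (cur (nth blank s i)) then c1 else c2) s t s' ->
  runs (If i P c1 c2) s t.+1 s'.
Proof.
have test : cstep (Some (entry (If i P c1 c2)), s) =
  (Some (Some (if P (cur (nth blank s i)) then inl (entry c1)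
               else inr (entry c2))), s).
  rewrite /cstep /=; congr (Some (Some (if P _ then _ else _)), s).
  (* Beyond the last tape, both sides read the default blank. *)
  by have [lt_i|le_i] := ltnP i (size s);
    [rewrite (nth_map blank) | rewrite !nth_default ?size_map].
case: (P _) test => test run.
  have [|u le_u eq_s'] := @runs_embed c1 (If i P c1 c2) (omap (Some \o inl))
    s t s' _ run; first by [].
  by exists u.+1; rewrite // iterSr test.
have [|u le_u eq_s'] := @runs_embed c2 (If i P c1 c2) (omap (Some \o inr))
  s t s' _ run; first by [].
by exists u.+1; rewrite // iterSr test.
Qed.

Lemma while_test i (P : pred symbol) c s :
  cstep (Some (entry (While i P c)), s) =
  (if P (cur (nth blank s i)) then Some (Some (entry c)) else None, s).
Proof.
rewrite /cstep /=; congr (if P _ then _ else _, s).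
by have [lt_i|le_i] := ltnP i (size s);
  [rewrite (nth_map blank) | rewrite !nth_default ?size_map].
Qed.

Lemma runs_while_stop i (P : pred symbol) c s :
  ~~ P (cur (nth blank s i)) -> runs (While i P c) s 1 s.
Proof. by move=> /negPf nP; exists 1; rewrite //= while_test nP. Qed.

Lemma runs_while_step i (P : pred symbol) c s t1 s1 t2 s2 :
    P (cur (nth blank s i)) -> runs c s t1 s1 ->
    runs (While i P c) s1 t2 s2 ->
  runs (While i P c) s (t1 + t2).+1 s2.
Proof.
move=> Ps run1 [u2 le_u2 eq_s2].
have [|u1 le_u1 eq_s1] := @runs_embed c (While i P c) Some s t1 s1 _ run1.
  by [].
exists (u2 + u1).+1; first by rewrite ltnS addnC leq_add.
by rewrite iterSr while_test Ps iterD eq_s1.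
Qed.

(** [S j] describes the tapes after [j] rounds. Each round pays one step for its test, and the
    failing test pays the last one. *)
Lemma runs_while i (P : pred symbol) c (S : nat -> seq tape) k T :
    (forall j, j < k -> P (cur (nth blank (S j) i)) /\
                        runs c (S j) T (S j.+1)) ->
    ~~ P (cur (nth blank (S k) i)) ->
  runs (While i P c) (S 0) (k * T.+1).+1 (S k).
Proof.
elim: k S => [|k IHk] S step stop; first exact: runs_while_stop.
have [P0 run0] := step 0 isT.
rewrite mulSn addSn -addnS; apply: (runs_while_step P0 run0).
by apply: (IHk (S \o succn)) => // j lt_jk; apply: step.
Qed.

(** For a loop consuming a list, the invariant is indexed by the part done and the part left. *)
Lemma runs_while_seq i (P : pred symbol) c (X : Type)
    (S : seq X -> seq X -> seq tape) T xs :
    (forall dn x rest, xs = dn ++ x :: rest ->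
       P (cur (nth blank (S dn (x :: rest)) i)) /\
       runs c (S dn (x :: rest)) T (S (rcons dn x) rest)) ->
    ~~ P (cur (nth blank (S xs [::]) i)) ->
  runs (While i P c) (S [::] xs) (size xs * T.+1).+1 (S xs [::]).
Proof.
move=> step stop.
have := @runs_while i P c (fun j => S (take j xs) (drop j xs)) (size xs) T.
rewrite take0 drop0 take_size drop_size; apply=> // j lt_j.
case: xs lt_j step stop => [|x0 xs] // lt_j step _.
rewrite (drop_nth x0) // (take_nth x0) //; apply: step.
by rewrite -drop_nth // cat_take_drop.
Qed.

(** * Loop-free programs, run by evaluation *)

Fixpoint loop_free (c : cmd) : bool :=
  match c with
  | Put _ _ | Go _ _ => true
  | Seq c1 c2 | If _ _ c1 c2 => loop_free c1 && loop_free c2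
  | While _ _ _ => false
  end.

Fixpoint eval (c : cmd) (s : seq tape) : seq tape :=
  match c with
  | Put i x => upd s i (write x (nth blank s i))
  | Go i d => upd s i (shift d (nth blank s i))
  | Seq c1 c2 => eval c2 (eval c1 s)
  | If i P c1 c2 => if P (cur (nth blank s i)) then eval c1 s else eval c2 s
  | While _ _ _ => s
  end.

(** A conditional is charged for both branches, which makes the bound independent of the tapes. *)
Fixpoint cost (c : cmd) : nat :=
  match c with
  | Put _ _ | Go _ _ => 1
  | Seq c1 c2 => cost c1 + cost c2
  | If _ _ c1 c2 => (cost c1 + cost c2).+1
  | While _ _ _ => 0
  end.

Lemma runs_eval c s : loop_free c -> runs c s (cost c) (eval c s).
Proof.
elim: c s => //= [i x|i d|c1 IH1 c2 IH2|i P c1 IH1 c2 IH2] s.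
- by move=> _; apply: runs_put.
- by move=> _; apply: runs_go.
- by case/andP=> lf1 lf2; apply: runs_seq (IH1 _ lf1) (IH2 _ lf2).
case/andP=> lf1 lf2; apply: runs_if; case: ifP => _.
  by apply: runs_le (IH1 _ lf1) _; rewrite leq_addr.
by apply: runs_le (IH2 _ lf2) _; rewrite leq_addl.
Qed.

(** * Compilation to machines *)

Section Compile.
Variables (N : nat) (c : cmd) (out : nat) (ok : pred symbol).

(** At the exit [inl None], one more step reads tape [out] and halts in a state [inr]. *)
Definition compile_trans (q : option (point c) + bool)
    (rd : {ffun 'I_N.+1 -> symbol}) :
    (option (point c) + bool) * ('I_N.+1 -> symbol * move) :=
  let syms := [seq rd i | i <- enum 'I_N.+1] in
  match q with
  | inl (Some p) => let r := next p syms in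
      (inl r.1, fun i : 'I_N.+1 => match r.2 with
                         | Some (j, inl x) =>
                             (if val i == j then x else rd i, Stay)
                         | Some (j, inr d) =>
                             (rd i, if val i == j then d else Stay)
                         | None => (rd i, Stay)
                         end)
  | inl None => (inr (ok (nth None syms out)), fun i => (rd i, Stay))
  | inr _ => (q, fun i => (rd i, Stay))
  end.

Definition compile : machine :=
  @Machine N (option (point c) + bool)%type (inl (Some (entry c)))
    (fun q => if q is inr b then Some b else None) compile_trans.

Definition implements (x : option (point c) * seq tape) (k : config compile) :=
  [/\ size x.2 = N.+1, cstate k = inl x.1,
      forall i, Defs.head k i = size (nth blank x.2 i).1 &
      forall i j, cell k i j = nth None (contents (nth blank x.2 i)) j].

Lemma implements_read x k : implements x k ->
  [seq [ffun i => cell k i (Defs.head k i)] i | i <- enum 'I_N.+1] =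
  map cur x.2.
Proof.
case=> sz _ hd ce; apply: (@eq_from_nth _ None).
  by rewrite size_map size_enum_ord size_map sz.
move=> i; rewrite size_map size_enum_ord => lt_i.
rewrite (nth_map ord0) ?size_enum_ord // (nth_map blank) ?sz // ffunE.
by rewrite hd ce nth_contents_cur nth_enum_ord.
Qed.

Lemma implements_step x k : implements x k -> isSome x.1 ->
  implements (cstep x) (step k).
Proof.
move=> im; have rd := implements_read im.
case: im; case: x rd => -[q|] //= s rd sz st hd ce _.
rewrite /step st /= /cstep /= rd; case: (next _ _) => o a /=.
split=> //=; first by rewrite size_act.
  move=> i; have lt_i : i < size s by rewrite sz.
  case: a => [[j [x|d]]|] /=; rewrite ?nth_upd //=.
    by case: ifP => // /eqP <-; rewrite hd.
  by case: ifP => [/eqP <-|_]; rewrite ?size_shift hd.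
move=> i p; have lt_i : i < size s by rewrite sz.
(* A tape that is not written to gets its current symbol back. *)
have same : (if p == Defs.head k i then [ffun i => cell k i (Defs.head k i)] i
    else cell k i p) = nth None (contents (nth blank s i)) p.
  by rewrite ffunE ce; case: eqP => [->|]; rewrite ?ce.
case: a => [[j [x|d]]|] //=; rewrite ?nth_upd //.
  case: (_ =P j) => [eq_ij|_]; last by rewrite same.
  by rewrite -eq_ij nth_contents_write hd ce.
by case: (_ =P j) => [<-|_]; rewrite same ?nth_contents_shift.
Qed.

Lemma compile_answers inp t s' :
    runs c ((([::], map Some inp) : tape) :: nseq N blank) t s' ->
  answers_within compile inp t.+1 (ok (cur (nth blank s' out))).
Proof.
case=> u le_ut eq_s'.
have im0 : implements
    (Some (entry c), (([::], map Some inp) : tape) :: nseq N blank)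
    (init compile inp).
  split=> //=; first by rewrite size_nseq.
    by case=> -[|i] //= lt_i; rewrite nth_nseq if_same.
  case=> -[|i] //= lt_i j; last first.
    by rewrite nth_nseq if_same /contents /= nth_nil.
  rewrite /contents /=; elim: inp j {eq_s'} => [|b inp IH] [|j] //=.
have dead (x : option (point c) * seq tape) : ~~ isSome x.1 -> cstep x = x.
  by case: x => -[].
have [v le_vu] := iter_simulation dead implements_step u im0.
rewrite eq_s' => im; have rd := implements_read im.
(* One step after the exit the verdict is reached, and it persists; hence an upper bound on the
   running time is enough. *)
have fin : forall w, verdict (cstate (iter w.+1 (@step compile)
    (iter v (@step compile) (init compile inp)))) =
    Some (ok (cur (nth blank s' out))).
  elim=> [|w IHw]; last by rewrite iterS /step IHw.
  case: im => sz st _ _; rewrite /= /step st /= rd.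
  congr (Some (ok _)).
  by have [lt_i|le_i] := ltnP out (size s');
    [rewrite (nth_map blank) | rewrite !nth_default ?size_map].
by rewrite /answers_within -(subnK (leq_trans le_vu le_ut)) -addSn iterD fin.
Qed.

End Compile.

(** * The program *)

Notation "c1 ;; c2" := (Seq c1 c2) (at level 61, right associativity).

(** Stops at the blank kept in front of every word. The first move leaves the blank on which the
    head stands after a full pass. *)
Definition rewind (i : nat) : cmd :=
  Go i Left ;; While i isSome (Go i Left) ;; Go i Right.

Definition is_bit (b : bool) (x : symbol) : bool := x == Some b.

Definition when (i : nat) (P : pred symbol) (c : cmd) : cmd :=
  If i P c (Go i Stay).

(** Counting saturates at the end of the ruler: it only matters whether the count reaches the
    length. *)
Definition bump (i : nat) : cmd := when i isSome (Go i Right).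

(* A signed counter is a stack of equal bits: [true] for positive values. *)
Definition count_bit (i : nat) (b : bool) : cmd :=
  If i (is_bit (~~ b)) (Put i None ;; Go i Left) (Go i Right ;; Put i (Some b)).

Definition empty_counter (i : nat) : cmd :=
  While i isSome (Put i None ;; Go i Left).

(* Next to the input there are two copies [tC], [tC'] of the characteristic
   vector of [c], that of the current rival [d] on [tD], rulers [tU] and [tL] of
   lengths [k.+1] and [k] along which the alternatives above [d] and those not
   below [c] are counted, a flag [tE] raised when [c] is above [d], the signed
   counters of the three comparisons, and a flag [tR] raised when some rival
   prevents [c] from winning alone. *)
Notation tIn := 0 (only parsing).
Notation tC := 1 (only parsing).
Notation tC' := 2 (only parsing).
Notation tD := 3 (only parsing).
Notation tU := 4 (only parsing).
Notation tL := 5 (only parsing).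
Notation tE := 6 (only parsing).
Notation tP := 7 (only parsing).
Notation tQ := 8 (only parsing).
Notation tG := 9 (only parsing).
Notation tR := 10 (only parsing).

(** The head of [tC] marks the row, that of [tD] the column. A 1 in the column of [d] is an
    alternative above [d]; a 0 in the row of [c] is one not below [c]. *)
Definition read_entry : cmd :=
  If tIn (is_bit true)
    (when tD (is_bit true)
       (bump tU ;; when tC (is_bit true) (Put tE (Some true))))
    (when tC (is_bit true) (bump tL)) ;;
  Go tIn Right ;; Go tD Right.

Definition read_row : cmd :=
  While tD isSome read_entry ;; rewind tD ;; Go tC Right.

(** [tU] not exhausted means that [d] fits in the top [k], [tL] exhausted that [c] can be kept out
    of the top [k.-1]. *)
Definition tally : cmd :=
  If tU isSome
    (count_bit tP true ;;
     If tL isSome (count_bit tQ false)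
       (count_bit tQ true ;; If tE isSome (Go tE Stay) (count_bit tG true)))
    (count_bit tP false ;;
     If tL isSome (count_bit tQ false ;; count_bit tG false)
       (count_bit tQ true)) ;;
  Put tE None.

(** The initial [bump] is the successor in [can_beat], counting [c] itself. *)
Definition read_vote : cmd :=
  bump tL ;; While tC isSome read_row ;; rewind tC ;;
  tally ;; rewind tU ;; rewind tL.

(** [tP] and [tG] must be positive, [tQ] only nonnegative. The bit on [tC'] prevents [c] from being
    its own rival. *)
Definition judge : cmd :=
  when tC' (is_bit false)
    (when tP (is_bit true) (If tQ (is_bit false) (Go tQ Stay)
       (when tG (is_bit true) (Put tR (Some true))))).

Definition next_rival : cmd :=
  While tD (is_bit false) (Go tD Right) ;;
  Put tD (Some false) ;; Go tD Right ;; when tD isSome (Put tD (Some true)) ;;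
  rewind tD ;; Go tC' Right.

Definition try_rival : cmd :=
  While tIn isSome read_vote ;; rewind tIn ;;
  judge ;; empty_counter tP ;; empty_counter tQ ;; empty_counter tG ;;
  next_rival.

(** Levels are tried downward: erasing the first cell of both rulers lowers [k] by 1. *)
Definition try_level : cmd :=
  Put tD (Some true) ;; While tC' isSome try_rival ;; rewind tC' ;;
  Put tU None ;; Go tU Right ;; Put tL None ;; Go tL Right.

Definition load_size : cmd :=
  Put tIn None ;; Go tIn Right ;; Put tD (Some false) ;; Go tD Right ;;
  Put tU (Some true) ;; Go tU Right ;; Put tL (Some true) ;; Go tL Right.

Definition load_bit : cmd :=
  If tIn (is_bit true) (Put tC (Some true) ;; Put tC' (Some true))
    (Put tC (Some false) ;; Put tC' (Some false)) ;;
  Put tIn None ;; Go tIn Right ;; Go tC Right ;; Go tC' Right ;; Go tD Right.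

(** The first moves leave the blank needed by [rewind]. [tD], filled with zeros, measures the
    characteristic vector, and the input is erased up to the matrices so that rewinding [tIn] stops
    there. *)
Definition load : cmd :=
  (Go tC Right ;; Go tC' Right ;; Go tD Right ;; Go tU Right ;; Go tL Right) ;;
  While tIn (is_bit true) load_size ;;
  (Put tIn None ;; Go tIn Right ;; Put tU (Some true)) ;;
  rewind tU ;; rewind tL ;; rewind tD ;;
  While tD isSome load_bit ;;
  rewind tC ;; rewind tC' ;; rewind tD.

Definition program : cmd := load ;; While tL isSome try_level.

(* The tape holding [w] after a blank (below which the tape reads [l]), with the
   head just after the prefix [v] of [w = v ++ u]. *)
Definition word (l : seq symbol) (v u : seq bool) : tape :=
  (rev (map Some v) ++ None :: l, map Some u).

Definition ruler (l : seq symbol) (k j : nat) : tape :=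
  word l (nseq (minn j k) true) (nseq (k - j) true).

Definition flag (b : bool) : tape := ([::], if b then [:: Some true] else [::]).

(** Cell 0 stays blank as the bottom; the head is on the last bit. *)
Definition stack (n : nat) (b : bool) : tape :=
  if n is n'.+1 then (rcons (nseq n' (Some b)) None, [:: Some b]) else blank.

Definition counter (a b : nat) : tape :=
  if b <= a then stack (a - b) true else stack (b - a) false.

Arguments word : simpl never.
Arguments ruler : simpl never.
Arguments flag : simpl never.
Arguments counter : simpl never.
Arguments cur : simpl never.
Arguments shift : simpl never.
Arguments write : simpl never.

(** * Elementary operations on the tape shapes *)

Lemma cur_word l v u : cur (word l v u) = ohead u.
Proof. by case: u. Qed.

Lemma right_word l v b u :
  shift Right (word l v (b :: u)) = word l (rcons v b) u.
Proof. by rewrite /word map_rcons rev_rcons. Qed.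

Lemma write_word l v b b' u :
  write (Some b') (word l v (b :: u)) = word l v (b' :: u).
Proof. by []. Qed.

Lemma stay t : shift Stay t = t. Proof. by []. Qed.

Lemma cur_flag b : cur (flag b) = if b then Some true else None.
Proof. by case: b. Qed.

Lemma set_flag b : write (Some true) (flag b) = flag true.
Proof. by case: b. Qed.

Lemma clear_flag b : write None (flag b) = flag false.
Proof. by case: b. Qed.

Lemma push_stack n b : write (Some b) (shift Right (stack n b)) = stack n.+1 b.
Proof. by case: n. Qed.

Lemma pop_stack n b : shift Left (write None (stack n.+1 b)) = stack n b.
Proof. by case: n. Qed.

Lemma cur_stack n b : cur (stack n b) = if n is 0 then None else Some b.
Proof. by case: n. Qed.

Lemma counter_swap a b : counter a b =
  if a <= b then stack (b - a) false else stack (a - b) true.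
Proof. by rewrite /counter; case: ltngtP => // ->; rewrite subnn. Qed.

Lemma cur_counter a b :
  cur (counter a b) =
  if b < a then Some true else if a < b then Some false else None.
Proof.
by rewrite /counter; case: ltngtP => [lt|lt|->]; rewrite cur_stack ?subnn //;
  rewrite -(subnKC lt) addSnnS addKn.
Qed.


Lemma upd_upd s i t t' : upd (upd s i t) i t' = upd s i t'.
Proof. by elim: s i => [|u s IHs] [|i] //=; rewrite IHs. Qed.

Lemma upd_id s i t : nth blank s i = t -> upd s i t = s.
Proof. by elim: s i => [|u s IHs] [|i] //= => [->|/IHs->]. Qed.

Lemma nth_updE s i t : i < size s -> nth blank (upd s i t) i = t.
Proof. by move=> lt_i; rewrite nth_upd ?eqxx. Qed.

Lemma eval_count_true s i m n : i < size s -> nth blank s i = counter m n ->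
  eval (count_bit i true) s = upd s i (counter m.+1 n).
Proof.
move=> lt_i eq_i; rewrite /count_bit /= eq_i !nth_updE ?size_upd // !upd_upd.
rewrite cur_counter; case: ltnP => [lt_nm|le_mn].
  by rewrite /counter ltnW // leqW 1?ltnW // subSn 1?ltnW // push_stack.
case: ltnP => [lt_mn|le_nm] /=.
  rewrite !counter_swap le_mn lt_mn (_ : n - m = (n - m.+1).+1); last by lia.
  by rewrite pop_stack.
have -> : m = n by lia.
by rewrite /counter leqnn leqnSn subnn subSnn push_stack.
Qed.

Lemma eval_count_false s i m n : i < size s -> nth blank s i = counter m n ->
  eval (count_bit i false) s = upd s i (counter m n.+1).
Proof.
move=> lt_i eq_i; rewrite /count_bit /= eq_i !nth_updE ?size_upd // !upd_upd.
rewrite cur_counter; case: ltnP => [lt_nm|le_mn] /=.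
  rewrite /counter lt_nm (ltnW lt_nm) (_ : m - n = (m - n.+1).+1); last by lia.
  by rewrite pop_stack.
rewrite !counter_swap le_mn leqW // subSn // -push_stack.
by case: ltnP.
Qed.

Lemma bump_ruler l k j :
  (if isSome (cur (ruler l k j)) then shift Right (ruler l k j)
   else ruler l k j) = ruler l k j.+1.
Proof.
rewrite /ruler cur_word; case: ltnP => [lt_jk|le_kj]; last first.
  by rewrite !(minn_idPr _) ?leqW // (eqP le_kj) (eqP (leqW le_kj)).
rewrite (_ : k - j = (k - j.+1).+1) //=; last by lia.
rewrite right_word -cats1 -[[:: true]]/(nseq 1 true) -nseqD.
by congr (word _ (nseq _ _) _); lia.
Qed.

Lemma eval_bump s i l k j : i < size s -> nth blank s i = ruler l k j ->
  eval (bump i) s = upd s i (ruler l k j.+1).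
Proof.
move=> lt_i eq_i; rewrite /bump /= eq_i -bump_ruler.
by case: ifP => _ //; rewrite stay.
Qed.

Lemma ruler_end l k j : isSome (cur (ruler l k j)) = (j < k).
Proof.
by rewrite /ruler cur_word -subn_gt0; case: (k - j).
Qed.

Lemma cur_before_word l u : cur (shift Left (word l [::] u)) = None.
Proof. by case: u. Qed.

Lemma right_before_word l u :
  shift Right (shift Left (word l [::] u)) = word l [::] u.
Proof. by case: u. Qed.

Lemma shrink_ruler l k :
  shift Right (write None (ruler l k.+1 0)) = ruler (None :: l) k 0.
Proof. by rewrite /ruler !min0n !subn0; case: k. Qed.

Lemma ruler0 l k : ruler l k 0 = word l [::] (nseq k true).
Proof. by rewrite /ruler min0n subn0. Qed.

Lemma counter0 : counter 0 0 = blank. Proof. by []. Qed.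

Lemma erase_symbol l x r :
  shift Right (write None (l, x :: r)) = (None :: l, r).
Proof. by case: r. Qed.

Lemma append_word l v b :
  shift Right (write (Some b) (word l v [::])) = word l (rcons v b) [::].
Proof. by rewrite /word map_rcons rev_rcons. Qed.

Lemma rewind_loop i s l v u : i < size s ->
  runs (While i isSome (Go i Left)) (upd s i (shift Left (word l v u)))
    (2 * size v).+1 (upd s i (shift Left (word l [::] (v ++ u)))).
Proof.
move=> lt_i; elim/last_ind: v u => [|v x IHv] u.
  by apply: runs_while_stop; rewrite nth_updE // cur_before_word.
have -> : shift Left (word l (rcons v x) u) = word l v (x :: u).
  by rewrite /word map_rcons rev_rcons.
rewrite size_rcons mulnS cat_rcons -[2 + _]/(1 + (2 * size v).+1).
apply: runs_while_step (IHv _); first by rewrite nth_updE // cur_word.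
by have := runs_go i Left (upd s i (word l v (x :: u)));
  rewrite nth_updE // upd_upd.
Qed.

Lemma runs_rewind i s l v u : i < size s -> nth blank s i = word l v u ->
  runs (rewind i) s (2 * size v + 3) (upd s i (word l [::] (v ++ u))).
Proof.
move=> lt_i eq_i.
have := runs_go i Left s; rewrite eq_i => back.
have := runs_go i Right (upd s i (shift Left (word l [::] (v ++ u)))).
rewrite nth_updE // upd_upd right_before_word => forth.
apply: runs_le (runs_seq back (runs_seq (rewind_loop _ _ _ lt_i) forth)) _.
by lia.
Qed.

Lemma rewind_ruler i s l k j : i < size s -> nth blank s i = ruler l k j ->
  runs (rewind i) s (2 * k + 3) (upd s i (ruler l k 0)).
Proof.
move=> lt_i eq_i; rewrite /ruler min0n subn0.
have -> : nseq k true = nseq (minn j k) true ++ nseq (k - j) true.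
  by rewrite -nseqD; congr nseq; lia.
apply: runs_le (runs_rewind lt_i eq_i) _.
by rewrite size_nseq leq_add2r leq_mul2l geq_minr.
Qed.

Lemma runs_empty_counter i s a b n : i < size s ->
    nth blank s i = counter a b -> a + b <= n ->
  runs (empty_counter i) s (n * 3).+1 (upd s i (counter 0 0)).
Proof.
move=> lt_i eq_i le_n.
have [c [d [def_s le_d]]] : exists c d, upd s i (stack c d) = s /\ c <= n.
  rewrite /counter in eq_i; case: ifP eq_i => _ eq_i.
    by exists (a - b), true; rewrite (upd_id eq_i); split=> //; lia.
  by exists (b - a), false; rewrite (upd_id eq_i); split=> //; lia.
rewrite -{1}def_s -[counter 0 0]/(stack 0 d).
apply: (@runs_le _ _ (c * 3).+1); last by rewrite ltnS leq_mul2r.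
elim: c {def_s le_d} => [|c IHc].
  by apply: runs_while_stop; rewrite nth_updE // cur_stack.
rewrite mulSn -[(3 + c * 3).+1]/((2 + (c * 3).+1).+1).
apply: runs_while_step IHc; first by rewrite nth_updE // cur_stack.
have := runs_put i None (upd s i (stack c.+1 d)).
rewrite nth_updE // upd_upd => erase.
have := runs_go i Left (upd s i (write None (stack c.+1 d))).
rewrite nth_updE // upd_upd pop_stack => back.
exact: runs_seq erase back.
Qed.

Opaque bump count_bit rewind ruler counter.

(* A processed matrix entry, for the row of [a] and the column of [b]: [a == c],
   [b == d] and whether [a] is above [b]. *)
Definition entry3 : Type := (bool * bool * bool)%type.

Definition over_rival (t : entry3) : bool := t.1.2 && t.2.
Definition not_under (t : entry3) : bool := t.1.1 && ~~ t.2.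
Definition over_pair (t : entry3) : bool := [&& t.1.1, t.1.2 & t.2].

Lemma eval_bumpU a0 a1 a2 a3 l k j s :
  eval (bump tU) [:: a0, a1, a2, a3, ruler l k j & s] =
  [:: a0, a1, a2, a3, ruler l k j.+1 & s].
Proof. exact: eval_bump. Qed.

Lemma eval_bumpL a0 a1 a2 a3 a4 l k j s :
  eval (bump tL) [:: a0, a1, a2, a3, a4, ruler l k j & s] =
  [:: a0, a1, a2, a3, a4, ruler l k j.+1 & s].
Proof. exact: eval_bump. Qed.

Lemma eval_countP a0 a1 a2 a3 a4 a5 a6 b m n s :
  eval (count_bit tP b) [:: a0, a1, a2, a3, a4, a5, a6, counter m n & s] =
  [:: a0, a1, a2, a3, a4, a5, a6, counter (b + m) (~~ b + n) & s].
Proof. by case: b; [apply: eval_count_true | apply: eval_count_false]. Qed.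

Lemma eval_countQ a0 a1 a2 a3 a4 a5 a6 a7 b m n s :
  eval (count_bit tQ b) [:: a0, a1, a2, a3, a4, a5, a6, a7, counter m n & s] =
  [:: a0, a1, a2, a3, a4, a5, a6, a7, counter (b + m) (~~ b + n) & s].
Proof. by case: b; [apply: eval_count_true | apply: eval_count_false]. Qed.

Lemma eval_countG a0 a1 a2 a3 a4 a5 a6 a7 a8 b m n s :
  eval (count_bit tG b)
    [:: a0, a1, a2, a3, a4, a5, a6, a7, a8, counter m n & s] =
  [:: a0, a1, a2, a3, a4, a5, a6, a7, a8, counter (b + m) (~~ b + n) & s].
Proof. by case: b; [apply: eval_count_true | apply: eval_count_false]. Qed.

(** * Reading the votes for one rival and one level *)

Section Votes.
Variables (lU lL : seq symbol) (k : nat).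

(** [ts] lists the entries of the current vote read so far, which determine the rulers and the flag;
    the successor on [tL] is the initial [bump]. *)
Definition reading (ts : seq entry3) (zin zC zC' zD zP zQ zG zR : tape) :
    seq tape :=
  [:: zin; zC; zC'; zD; ruler lU k.+1 (count over_rival ts);
      ruler lL k (count not_under ts).+1; flag (has over_pair ts);
      zP; zQ; zG; zR].

Lemma eval_read_entry ts x y o l v u lD vD uD zC zC' zP zQ zG zR :
    cur zC = Some x ->
  eval read_entry (reading ts (word l v (o :: u)) zC zC'
    (word lD vD (y :: uD)) zP zQ zG zR) =
  reading (rcons ts (x, y, o)) (word l (rcons v o) u) zC zC'
    (word lD (rcons vD y) uD) zP zQ zG zR.
Proof.
move=> curC; rewrite /reading /read_entry /when /= !cur_word curC /=.
rewrite -(cats1 ts) !count_cat has_cat /= !orbF !addn0.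
by case: x y o curC => [] [] [] curC /=;
  rewrite ?eval_bumpU ?eval_bumpL //= ?curC /= ?set_flag ?stay ?right_word
    ?addn0 ?addn1 ?orbF ?orbT.
Qed.

Definition row_entries (chid : seq bool) (xr : bool * seq bool) :
    seq entry3 :=
  [seq (xr.1, yb.1, yb.2) | yb <- zip chid xr.2].

(** This and the later time bounds copy the shape of the programs, so that the rules for sequences
    and loops apply directly. *)
Definition row_time (m : nat) : nat :=
  (m * (cost read_entry).+1).+1 + (2 * m + 3 + 1).

Lemma runs_read_row ts x row l v u lC vC uC zC' lD chid zP zQ zG zR :
    size row = size chid ->
  runs read_row
    (reading ts (word l v (row ++ u)) (word lC vC (x :: uC)) zC'
       (word lD [::] chid) zP zQ zG zR)
    (row_time (size chid))
    (reading (ts ++ row_entries chid (x, row)) (word l (v ++ row) u)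
       (word lC (rcons vC x) uC) zC' (word lD [::] chid) zP zQ zG zR).
Proof.
move=> sz.
pose S (dn rest : seq (bool * bool)) :=
  reading (ts ++ [seq (x, yb.1, yb.2) | yb <- dn])
    (word l (v ++ unzip2 dn) (unzip2 rest ++ u)) (word lC vC (x :: uC)) zC'
    (word lD (unzip1 dn) (unzip1 rest)) zP zQ zG zR.
have loop : runs (While tD isSome read_entry) (S [::] (zip chid row))
    ((size chid * (cost read_entry).+1).+1) (S (zip chid row) [::]).
  have -> : size chid = size (zip chid row) by rewrite size_zip sz minnn.
  apply: runs_while_seq => // dn [y b] rest _; split=> //.
  rewrite /S /unzip1 /unzip2 !map_rcons -!rcons_cat /=.
  rewrite -(@eval_read_entry _ x y b) ?cur_word //.
  exact: runs_eval.
have [sz1 sz2] : size chid <= size row /\ size row <= size chid by rewrite sz.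
rewrite /S /= cats0 unzip1_zip // unzip2_zip // cats0 in loop.
apply: runs_seq (loop) _; apply: runs_seq.
  exact: (@runs_rewind tD _ lD chid [::]).
rewrite /= cats0 /reading -right_word; exact: runs_go.
Qed.

Definition vote_entries (chic chid : seq bool) (vote : seq (seq bool)) :
    seq entry3 :=
  flatten [seq row_entries chid xr | xr <- zip chic vote].

Lemma runs_rows ts vote l v u lC chic zC' lD chid zP zQ zG zR :
    size vote = size chic -> all (fun row => size row == size chid) vote ->
  runs (While tC isSome read_row)
    (reading ts (word l v (flatten vote ++ u)) (word lC [::] chic) zC'
       (word lD [::] chid) zP zQ zG zR)
    ((size chic * (row_time (size chid)).+1).+1)
    (reading (ts ++ vote_entries chic chid vote) (word l (v ++ flatten vote) u)
       (word lC chic [::]) zC' (word lD [::] chid) zP zQ zG zR).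
Proof.
move=> sz /allP szr.
have [sz1 sz2] : size chic <= size vote /\ size vote <= size chic by rewrite sz.
pose S (dn rest : seq (bool * seq bool)) :=
  reading (ts ++ flatten [seq row_entries chid xr | xr <- dn])
    (word l (v ++ flatten (unzip2 dn)) (flatten (unzip2 rest) ++ u))
    (word lC (unzip1 dn) (unzip1 rest)) zC' (word lD [::] chid) zP zQ zG zR.
have := @runs_while_seq tC isSome read_row _ S (row_time (size chid))
  (zip chic vote).
rewrite /S /= !cats0 unzip1_zip // unzip2_zip // size1_zip //.
apply=> // dn [x row] rest eq_xs; split=> //=.
rewrite /unzip1 /unzip2 !map_rcons !flatten_rcons !catA /= -catA.
apply: runs_read_row; apply/eqP/szr.
rewrite -(unzip2_zip sz2) eq_xs /unzip2 map_cat mem_cat.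
by rewrite inE eqxx orbT.
Qed.

(** With the next three predicates, this expresses [p], [q] and the two sides of the third
    comparison in [can_beat] through the entries of a vote. *)
Definition rival_fits (ts : seq entry3) : bool := count over_rival ts <= k.

Definition delayed (ts : seq entry3) : bool := k <= (count not_under ts).+1.

Definition favorable (ts : seq entry3) : bool :=
  [&& rival_fits ts, delayed ts & ~~ has over_pair ts].

Definition unfavorable (ts : seq entry3) : bool :=
  ~~ rival_fits ts && ~~ delayed ts.

Definition voting (vs : seq (seq entry3)) (zin zC zC' zD zU zL zE zR : tape) :
    seq tape :=
  [:: zin; zC; zC'; zD; zU; zL; zE;
      counter (count rival_fits vs) (count (predC rival_fits) vs);
      counter (count delayed vs) (count (predC delayed) vs);
      counter (count favorable vs) (count unfavorable vs); zR].

Lemma eval_tally vs ts zin zC zC' zD zR : let zE := flag (has over_pair ts) in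
  let zU := ruler lU k.+1 (count over_rival ts) in
  let zL := ruler lL k (count not_under ts).+1 in
  eval tally (voting vs zin zC zC' zD zU zL zE zR) =
  voting (rcons vs ts) zin zC zC' zD zU zL (flag false) zR.
Proof.
rewrite /voting /tally /= !ruler_end ltnS -(cats1 vs) !count_cat /= !addn0.
rewrite /favorable /unfavorable /= /rival_fits /delayed.
case: (count _ _ <= k); rewrite ?eval_countP /= ?ruler_end ltnNge;
  case: (k <= _); rewrite ?eval_countQ /= ?cur_flag ?eval_countG /=
    ?addn0 ?addn1 ?clear_flag //.
by case: (has _ _); rewrite /= ?eval_countG /= ?clear_flag ?stay
  ?addn0 ?addn1.
Qed.

Definition vote_time (m : nat) : nat :=
  cost (bump tL) + ((m * (row_time m).+1).+1 + ((2 * m + 3) +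
    (cost tally + ((2 * m.+1 + 3) + (2 * m + 3))))).

Lemma runs_read_vote vs vote l v u lC chic zC' lD chid zR m : k <= m ->
    size chic = m -> size chid = m -> size vote = m ->
    all (fun row => size row == m) vote ->
  let S vs v u := voting vs (word l v u) (word lC [::] chic) zC'
    (word lD [::] chid) (ruler lU k.+1 0) (ruler lL k 0) (flag false) zR in
  runs read_vote (S vs v (flatten vote ++ u)) (vote_time m)
    (S (rcons vs (vote_entries chic chid vote)) (v ++ flatten vote) u).
Proof.
move=> le_km szC szD szV szR /=; apply: runs_seq; first exact: runs_eval.
rewrite /voting eval_bumpL; apply: runs_seq.
  have := @runs_rows [::] vote l v u lC chic zC' lD chid.
  by rewrite szC szD szV => rows; apply: rows.
apply: runs_seq.
  by rewrite -szC; apply: (@runs_rewind tC _ lC chic [::]).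
apply: runs_seq; first exact: runs_eval.
rewrite cat0s cats0 [upd _ _ _]/(voting vs _ _ _ _ _ _ _ _) eval_tally.
apply: (@runs_le _ _ (2 * k.+1 + 3 + (2 * k + 3))); last by lia.
apply: runs_seq; first exact: (@rewind_ruler tU _ lU k.+1).
exact: (@rewind_ruler tL _ lL k).
Qed.

Definition votes_time (m n : nat) : nat :=
  (n * (vote_time m).+1).+1.

Lemma runs_votes votes l chic lC zC' lD chid zR m : 0 < m -> k <= m ->
    size chic = m -> size chid = m ->
    all (fun vote => (size vote == m) && all (fun row => size row == m) vote)
      votes ->
  let S vs v u := voting vs (word l v u) (word lC [::] chic) zC'
    (word lD [::] chid) (ruler lU k.+1 0) (ruler lL k 0) (flag false) zR in
  let data := flatten (map flatten votes) in
  runs (While tIn isSome read_vote) (S [::] [::] data)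
    (votes_time m (size votes))
    (S [seq vote_entries chic chid vote | vote <- votes] data [::]).
Proof.
move=> m_gt0 le_km szC szD /allP sz S data.
pose S' dn rest := S [seq vote_entries chic chid vote | vote <- dn]
  (flatten (map flatten dn)) (flatten (map flatten rest)).
apply: (@runs_while_seq tIn isSome _ _ S') => // dn vote rest eq_votes.
have /sz/andP[/eqP szV szR] : vote \in votes.
  by rewrite eq_votes mem_cat inE eqxx orbT.
split.
  (* As [m] is positive, an unread vote leaves a bit under the head of [tIn]. *)
  rewrite /= cur_word; case: vote szV szR {eq_votes} => [|row vote] /=.
    by move=> m0; rewrite -m0 in m_gt0.
  by move=> _ /andP[/eqP]; case: row => // m0; rewrite -m0 in m_gt0.
rewrite /S' !map_rcons flatten_rcons; exact: runs_read_vote.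
Qed.

End Votes.

(** * Judging a rival and passing to the next *)

Lemma runs_scan i s l b v n u : i < size s ->
    nth blank s i = word l v (nseq n b ++ u) -> ohead u != Some b ->
  runs (While i (is_bit b) (Go i Right)) s (n * 2).+1
    (upd s i (word l (v ++ nseq n b) u)).
Proof.
move=> lt_i eq_i neq_b; rewrite -{1}(upd_id eq_i).
elim: n v {eq_i} => [|n IHn] v.
  by rewrite cats0; apply: runs_while_stop; rewrite nth_updE // cur_word.
rewrite -cat_rcons mulSn -[(2 + n * 2).+1]/((1 + (n * 2).+1).+1).
apply: runs_while_step (IHn _); rewrite ?nth_updE // ?cur_word /is_bit ?eqxx //.
have := runs_go i Right (upd s i (word l v (nseq n.+1 b ++ u))).
by rewrite nth_updE // upd_upd /= right_word.
Qed.

(* The mark of the rival at index [i], on a tape of length [m]; no mark when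
   [i = m]. *)
Definition mark (m i : nat) : seq bool := mkseq (pred1 i) m.

Lemma markE m i : i < m ->
  mark m i = nseq i false ++ true :: nseq (m - i.+1) false.
Proof.
move=> lt_im; apply: (@eq_from_nth _ false) => [|j].
  by rewrite size_mkseq size_cat /= !size_nseq; lia.
rewrite size_mkseq => lt_jm; rewrite nth_mkseq // nth_cat size_nseq /=.
case: ltngtP => [lt_ji|lt_ij|->]; rewrite ?nth_nseq ?lt_ji ?subnn //.
by rewrite -(subnKC lt_ij) addSnnS addKn /= nth_nseq if_same.
Qed.

Lemma mark_end m : mark m m = nseq m false.
Proof.
apply: (@eq_from_nth _ false) => [|j]; rewrite size_mkseq ?size_nseq // => lt_j.
by rewrite nth_mkseq // nth_nseq lt_j /= ltn_eqF.
Qed.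

Definition next_rival_time (m : nat) : nat :=
  (m * 2).+1 + (1 + (1 + (cost (when tD isSome (Put tD (Some true))) +
    ((2 * m + 3) + 1)))).

Lemma runs_next_rival zin zC lC vC x uC lD m i s : i < m ->
  runs next_rival
    [:: zin, zC, word lC vC (x :: uC), word lD [::] (mark m i) & s]
    (next_rival_time m)
    [:: zin, zC, word lC (rcons vC x) uC, word lD [::] (mark m i.+1) & s].
Proof.
move=> lt_im; rewrite (markE lt_im).
apply: runs_seq.
  apply: (@runs_le _ _ (i * 2).+1); last by rewrite ltnS leq_mul2r ltnW.
  by apply: (@runs_scan tD _ lD false [::]).
rewrite /=; apply: runs_seq; first exact: runs_put.
rewrite /= write_word; apply: runs_seq; first exact: runs_go.
rewrite /= right_word; apply: runs_seq; first exact: runs_eval.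
have -> : eval (when tD isSome (Put tD (Some true)))
   [:: zin, zC, word lC vC (x :: uC),
       word lD (rcons (nseq i false) false) (nseq (m - i.+1) false) & s] =
   [:: zin, zC, word lC vC (x :: uC),
       word lD (nseq i.+1 false) (drop i.+1 (mark m i.+1)) & s].
  rewrite /when /= cur_word -cats1 -[[:: false]]/(nseq 1 false) -nseqD addn1.
  (* After the last rival the head is on the blank behind the word, and the mark disappears. *)
  have [lt_im1|le_mi1] := ltnP i.+1 m; last first.
    have def_m : m = i.+1 by lia.
    by rewrite def_m subnn mark_end drop_nseq subnn /= stay.
  rewrite (markE lt_im1) drop_size_cat ?size_nseq //.
  by rewrite (_ : m - i.+1 = (m - i.+2).+1) //; lia.
apply: runs_seq.
  apply: (@runs_le _ _ (2 * size (nseq i.+1 false) + 3)).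
    exact: (@runs_rewind tD _ lD).
  by rewrite size_nseq; lia.
have -> : nseq i.+1 false ++ drop i.+1 (mark m i.+1) = mark m i.+1.
  rewrite -[RHS](cat_take_drop i.+1); congr cat.
  apply: (@eq_from_nth _ false) => [|j].
    by rewrite size_nseq size_takel // size_mkseq.
  rewrite size_nseq => lt_ji; rewrite nth_nseq lt_ji nth_take //.
  by rewrite nth_mkseq ?(leq_trans lt_ji) //= ltn_eqF.
rewrite -right_word; exact: runs_go.
Qed.

Definition overtakes (k : nat) (vs : seq (seq entry3)) : bool :=
  [&& count (predC (rival_fits k)) vs < count (rival_fits k) vs,
      count (predC (delayed k)) vs <= count (delayed k) vs &
      count (unfavorable k) vs < count (favorable k) vs].

Lemma eval_judge a0 a1 a3 a4 a5 a6 lC vC x uC k vs r :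
  eval judge [:: a0; a1; word lC vC (x :: uC); a3; a4; a5; a6;
    counter (count (rival_fits k) vs) (count (predC (rival_fits k)) vs);
    counter (count (delayed k) vs) (count (predC (delayed k)) vs);
    counter (count (favorable k) vs) (count (unfavorable k) vs); flag r] =
  [:: a0; a1; word lC vC (x :: uC); a3; a4; a5; a6;
    counter (count (rival_fits k) vs) (count (predC (rival_fits k)) vs);
    counter (count (delayed k) vs) (count (predC (delayed k)) vs);
    counter (count (favorable k) vs) (count (unfavorable k) vs);
    flag (r || ~~ x && overtakes k vs)].
Proof.
rewrite /judge /when /= cur_word !cur_counter /overtakes /=.
case: x; rewrite /= ?stay ?orbF //.
case: ltnP => _ /=; last by case: ltnP => _ /=; rewrite ?stay ?orbF.
case: (ltngtP (count (delayed k) vs)) => _ /=; rewrite ?stay ?orbF //;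
  by case: ltnP => _ /=; rewrite ?set_flag ?orbT //;
    case: ltnP => _ /=; rewrite ?stay ?orbF.
Qed.

Lemma nseqSr (T : Type) i (x : T) : nseq i.+1 x = rcons (nseq i x) x.
Proof. by elim: i => //= i <-. Qed.

Lemma has_iotaS (p : pred nat) i :
  has p (iota 0 i.+1) = has p (iota 0 i) || p i.
Proof. by rewrite -addn1 iotaD has_cat /= orbF. Qed.

(** Emptying a counter takes three steps per bit; [2 * n] bounds the bits, both of its counts being
    at most [n]. The parameter [d] is the length of the matrices. *)
Definition rival_time (m n d : nat) : nat :=
  votes_time m n + ((2 * d + 3) + (cost judge +
    ((2 * n * 3).+1 + ((2 * n * 3).+1 + ((2 * n * 3).+1 +
      next_rival_time m))))).

Definition level_time (m n d : nat) : nat :=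
  1 + ((m * (rival_time m n d).+1).+1 + ((2 * m + 3) +
    cost (Put tU None ;; Go tU Right ;; Put tL None ;; Go tL Right))).

Definition search_time (m n d : nat) : nat := (m * (level_time m n d).+1).+1.

(** * Search over all rivals and levels *)

Section Rivals.
Variables (m n : nat) (votes : seq (seq (seq bool))) (chic : seq bool).
Variables (l lC lC' lD : seq symbol).
Let data := flatten (map flatten votes).
Hypotheses (m_gt0 : 0 < m) (szC : size chic = m) (szV : size votes = n).
Hypothesis sz_votes :
  all (fun vote => (size vote == m) && all (fun row => size row == m) vote)
    votes.

Definition rival_overtakes (k i : nat) : bool :=
  ~~ nth false chic i &&
  overtakes k [seq vote_entries chic (mark m i) vote | vote <- votes].

Definition trying (lU lL : seq symbol) (k : nat) (vC uC chid : seq bool)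
    (r : bool) : seq tape :=
  [:: word l [::] data; word lC [::] chic; word lC' vC uC; word lD [::] chid;
      ruler lU k.+1 0; ruler lL k 0; flag false;
      counter 0 0; counter 0 0; counter 0 0; flag r].

Lemma runs_try_rival lU lL k vC x uC r : k <= m -> chic = vC ++ x :: uC ->
  runs try_rival (trying lU lL k vC (x :: uC) (mark m (size vC)) r)
    (rival_time m n (size data))
    (trying lU lL k (rcons vC x) uC (mark m (size vC).+1)
      (r || rival_overtakes k (size vC))).
Proof.
move=> le_km def_chic; set i := size vC.
have lt_im : i < m by rewrite -szC def_chic size_cat /= -addSnnS leq_addr.
have nth_i : nth false chic i = x by rewrite def_chic nth_cat ltnn subnn.
pose vs := [seq vote_entries chic (mark m i) vote | vote <- votes].
have le_count (p : pred (seq entry3)) : count p vs <= n.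
  by rewrite -szV -(size_map (vote_entries chic (mark m i))) count_size.
apply: runs_seq.
  rewrite -szV; apply: (@runs_votes lU lL k _ l chic) => //.
  by rewrite size_mkseq.
apply: runs_seq; first exact: (@runs_rewind tIn _ l data [::]).
rewrite /voting /= cats0; apply: runs_seq; first exact: runs_eval.
rewrite eval_judge -nth_i -/(rival_overtakes k i).
apply: runs_seq.
  apply: (@runs_empty_counter tP _ _ _ (2 * n)) => //.
  by rewrite mul2n -addnn leq_add.
apply: runs_seq.
  apply: (@runs_empty_counter tQ _ _ _ (2 * n)) => //.
  by rewrite mul2n -addnn leq_add.
apply: runs_seq.
  apply: (@runs_empty_counter tG _ _ _ (2 * n)) => //.
  by rewrite mul2n -addnn leq_add.
rewrite /= nth_i; exact: runs_next_rival.
Qed.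

Lemma runs_try_level lU lL k r : k < m ->
  runs try_level (trying lU lL k.+1 [::] chic (mark m m) r)
    (level_time m n (size data))
    (trying (None :: lU) (None :: lL) k [::] chic (mark m m)
      (r || has (rival_overtakes k.+1) (iota 0 m))).
Proof.
move=> lt_km; apply: runs_seq; first exact: runs_put.
pose S vC uC := trying lU lL k.+1 vC uC (mark m (size vC))
  (r || has (rival_overtakes k.+1) (iota 0 (size vC))).
have := @runs_while_seq tC' isSome try_rival _ S
  (rival_time m n (size data)) chic.
rewrite szC /S szC /= orbF => loop; apply: runs_seq.
  (* [mark m m] is all zeros, so marking its first cell selects the rival at index 0. *)
  rewrite /= mark_end -{1}(prednK m_gt0) /= write_word.
  have -> : true :: nseq m.-1 false = mark m 0.
    by rewrite (markE m_gt0) subn1.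
  apply: loop => // vC x uC def_chic; split=> //.
  rewrite size_rcons has_iotaS orbA.
  exact: runs_try_rival.
have back := @runs_rewind tC' (trying lU lL k.+1 chic [::] (mark m m)
  (r || has (rival_overtakes k.+1) (iota 0 m))) lC' chic [::] isT erefl.
rewrite szC cats0 in back; apply: runs_seq; first exact: back.
rewrite /trying -!shrink_ruler; exact: runs_eval.
Qed.

Lemma runs_search lU lL :
  let S k lU lL := trying lU lL k [::] chic (mark m m) in
  runs (While tL isSome try_level) (S m lU lL false)
    (search_time m n (size data))
    (S 0 (nseq m None ++ lU) (nseq m None ++ lL)
       (has (fun k => has (rival_overtakes k) (iota 0 m)) (iota 1 m))).
Proof.
move=> S.
pose overtaken k := has (rival_overtakes k) (iota 0 m).
(* After [j] rounds the levels from [m] down to [m - j + 1] have been tried. *)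
pose S' j := S (m - j) (nseq j None ++ lU) (nseq j None ++ lL)
  (has (fun k => overtaken (m - k)) (iota 0 j)).
have -> : S m lU lL false = S' 0 by rewrite /S' subn0.
rewrite -/overtaken.
have -> : has overtaken (iota 1 m) =
    has (fun k => overtaken (m - k)) (iota 0 m).
  apply/hasP/hasP => -[k]; rewrite mem_iota => lt_km ok_k.
    by exists (m - k); [rewrite mem_iota; lia | rewrite subKn //; lia].
  by exists (m - k) => //; rewrite mem_iota; lia.
have -> : S 0 (nseq m None ++ lU) (nseq m None ++ lL)
    (has (fun k => overtaken (m - k)) (iota 0 m)) = S' m.
  by rewrite /S' subnn.
apply: runs_while => [j lt_jm|]; last by rewrite /S' /= ruler_end subnn.
rewrite /S'.
split; first by rewrite ruler_end subn_gt0.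
rewrite has_iotaS (_ : m - j = (m - j.+1).+1); last by lia.
by apply: runs_try_level; lia.
Qed.

End Rivals.

(** * Loading the input *)

Definition load_time (m : nat) : nat :=
  5 + ((m * (cost load_size).+1).+1 + (3 + ((2 * m + 3) + ((2 * m + 3) +
    ((2 * m + 3) + ((m * (cost load_bit).+1).+1 + ((2 * m + 3) + ((2 * m + 3) +
      (2 * m + 3))))))))).

(** In front of the matrices lie [m.+1] erased cells of the unary size and [m] of the characteristic
    vector; [word] supplies one of these blanks, hence [m + m]. *)
Lemma runs_load m votes chic : let data := flatten (map flatten votes) in
    size chic = m ->
  runs load
    ((([::], map Some (nseq m true ++ false :: chic ++ data)) : tape)
       :: nseq 10 blank)
    (load_time m)
    (trying votes chic (nseq (m + m) None) [::] [::] [::] [::] [::] m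
       [::] chic (mark m m) false).
Proof.
move=> data szC.
have rw i s v u : i < size s -> nth blank s i = word [::] v u -> size v = m ->
    runs (rewind i) s (2 * m + 3) (upd s i (word [::] [::] (v ++ u))).
  by move=> lt_i eq_i <-; apply: runs_rewind.
apply: runs_seq; first exact: runs_eval.
pose S j := [::
  (nseq j None, map Some (nseq (m - j) true ++ false :: chic ++ data));
  word [::] [::] [::]; word [::] [::] [::]; word [::] (nseq j false) [::];
  word [::] (nseq j true) [::]; word [::] (nseq j true) [::];
  blank; blank; blank; blank; blank].
apply: runs_seq.
  have := @runs_while tIn (is_bit true) load_size S m (cost load_size).
  rewrite [S 0]/S subn0; apply=> [j lt_jm|]; last by rewrite /S /= subnn.
  rewrite /S (_ : m - j = (m - j.+1).+1); last by lia.
  split=> //.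
  rewrite (nseqSr j true) (nseqSr j false).
  rewrite -!append_word -(erase_symbol _ (Some true)); exact: runs_eval.
apply: runs_seq; first exact: runs_eval.
rewrite /S subnn /= erase_symbol.
apply: runs_seq.
  by apply: (rw tU _ (nseq m true) [:: true]) => //; rewrite size_nseq.
apply: runs_seq; first by apply: (rw tL) => //; rewrite size_nseq.
apply: runs_seq; first by apply: (rw tD) => //; rewrite size_nseq.
rewrite /= !cats0.
pose S' (v u : seq bool) :=
  [:: (nseq (m.+1 + size v) None, map Some (u ++ data));
  word [::] v [::]; word [::] v [::];
  word [::] (nseq (size v) false) (nseq (size u) false);
  word [::] [::] (nseq m true ++ [:: true]); word [::] [::] (nseq m true);
  blank; blank; blank; blank; blank].
apply: runs_seq.
  have := @runs_while_seq tD isSome load_bit _ S' (cost load_bit) chic.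
  rewrite [S' [::] _]/S' /= szC addn0; apply=> // v x u _; split=> //.
  have <- : eval load_bit (S' v (x :: u)) = S' (rcons v x) u.
    rewrite /S' size_rcons addnS (nseqSr _ false) /load_bit /=.
    by case: x; rewrite /= ?append_word right_word erase_symbol.
  exact: runs_eval.
rewrite {1}/S' /= szC.
apply: runs_seq; first exact: (rw tC _ chic [::]).
apply: runs_seq; first exact: (rw tC' _ chic [::]).
rewrite /trying ruler0 ruler0 counter0 mark_end.
have -> : nseq m.+1 true = nseq m true ++ [:: true].
  by rewrite (nseqSr m true) cats1.
rewrite -[flag false]/blank.
have := rw tD _ (nseq m false) [::].
rewrite !cats0; apply => //. by rewrite size_nseq.
Qed.

Definition program_time (m n d : nat) : nat :=
  load_time m + search_time m n d.

Lemma runs_program m votes chic : 0 < m -> size chic = m ->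
    all (fun vote => (size vote == m) && all (fun row => size row == m) vote)
      votes ->
  exists2 s, runs program
    ((([::], map Some (nseq m true ++ false :: chic ++
        flatten (map flatten votes))) : tape) :: nseq 10 blank)
    (program_time m (size votes) (size (flatten (map flatten votes)))) s &
    nth blank s tR = flag (has (fun k =>
      has (rival_overtakes m votes chic k) (iota 0 m)) (iota 1 m)).
Proof.
move=> m_gt0 szC szV.
have search := runs_search (nseq (m + m) None) [::] [::] [::] m_gt0 szC erefl
  szV [::] [::].
by eexists; first exact: runs_seq (runs_load votes szC) search.
Qed.

(** * Correctness and running time *)

Definition polynomial (f : nat -> nat) : Prop :=
  exists p : {poly nat}, forall x, f x = horner p x.

Lemma polynomial_id : polynomial (fun x => x).
Proof. by exists 'X%R => x; rewrite hornerX. Qed.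

Lemma polynomial_const k : polynomial (fun=> k).
Proof. by exists (polyC k) => x; rewrite hornerC. Qed.

Lemma polynomial_add f g : polynomial f -> polynomial g ->
  polynomial (fun x => f x + g x).
Proof.
by move=> [p fE] [q gE]; exists (p + q)%R => x; rewrite hornerD -fE -gE.
Qed.

Lemma polynomial_mul f g : polynomial f -> polynomial g ->
  polynomial (fun x => f x * g x).
Proof.
by move=> [p fE] [q gE]; exists (p * q)%R => x; rewrite hornerM -fE -gE.
Qed.

Lemma polynomial_succ f : polynomial f -> polynomial (fun x => (f x).+1).
Proof. exact: polynomial_add (polynomial_const 1). Qed.

Lemma polynomial_program_time : polynomial (fun x => program_time x x x).
Proof.
rewrite /program_time /load_time /search_time /level_time /rival_time.
rewrite /votes_time /next_rival_time /vote_time /row_time.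
by repeat first [exact: polynomial_const | exact: polynomial_id
  | apply: polynomial_succ | apply: polynomial_add | apply: polynomial_mul].
Qed.

(** The three parameters are at most the input length, so monotonicity reduces the bound to one
    variable. *)
Lemma program_time_mono m n d x : m <= x -> n <= x -> d <= x ->
  program_time m n d <= program_time x x x.
Proof.
move=> le_m le_n le_d.
rewrite /program_time /load_time /search_time /level_time /rival_time.
rewrite /votes_time /next_rival_time /vote_time /row_time.
by repeat first [exact: leqnn | assumption | rewrite ltnS | apply: leq_add
  | apply: leq_mul].
Qed.

(** Bounds the number of votes by the length of the input. *)
Lemma size_le_flatten (T : Type) (ss : seq (seq T)) :
  all (fun s => 0 < size s) ss -> size ss <= size (flatten ss).
Proof.
elim: ss => //= s ss IHss /andP[s_gt0 /IHss le_ss].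
by rewrite size_cat -add1n leq_add.
Qed.

Lemma count_grid (C : finType) (T : Type) (F : C -> C -> T) (p : pred T) :
  count p (flatten [seq [seq F a b | b <- enum C] | a <- enum C]) =
  \sum_a \sum_b (p (F a b) : nat).
Proof.
rewrite count_flatten -map_comp sumnE big_map big_enum /=.
apply: eq_bigr => a _; rewrite count_map -sum1_count big_mkcond big_enum /=.
by apply: eq_bigr => b _; case: (p _).
Qed.

(** * The counts obtained from an encoded profile *)

Section Encoding.
Variables (C : finType) (n : nat) (O : profile C n) (c : C).

Let m := #|C|.
Let chic := [seq a == c | a <- enum C].
Let vote i := [seq [seq O i a b | b <- enum C] | a <- enum C].
Let votes := [seq vote i | i <- enum 'I_n].

Lemma encodeE :
  encode O c = nseq m true ++ false :: chic ++ flatten (map flatten votes).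
Proof. by rewrite /encode /votes -map_comp. Qed.

Lemma size_votes :
  all (fun vote => (size vote == m) && all (fun row => size row == m) vote)
    votes.
Proof.
apply/allP => _ /mapP[i _ ->]; rewrite size_map -cardE eqxx /=.
by apply/allP => _ /mapP[a _ ->]; rewrite size_map -cardE.
Qed.

Lemma nth_enum_rankE d j : j < m ->
  (nth d (enum C) j == d) = (j == enum_rank d).
Proof.
move=> lt_j; rewrite -{2}(nth_enum_rank d d) nth_uniq ?enum_uniq //.
  by rewrite -cardE.
by rewrite -cardE ltn_ord.
Qed.

Lemma mark_enum_rank d : mark m (enum_rank d) = [seq b == d | b <- enum C].
Proof.
apply: (@eq_from_nth _ false) => [|j]; rewrite size_mkseq.
  by rewrite size_map -cardE.
move=> lt_j; rewrite nth_mkseq // (nth_map d) -?cardE //=.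
by rewrite nth_enum_rankE.
Qed.

Lemma entriesE d i : vote_entries chic (mark m (enum_rank d)) (vote i) =
  flatten [seq [seq (a == c, b == d, O i a b) | b <- enum C] | a <- enum C].
Proof.
rewrite /vote_entries /chic /vote zip_map -map_comp; congr flatten.
by apply: eq_map => a; rewrite /= /row_entries mark_enum_rank zip_map -map_comp.
Qed.

Lemma sum_pick (d : C) (F : C -> nat) : \sum_b (b == d) * F b = F d.
Proof.
rewrite (bigD1 d) //= eqxx mul1n big1 ?addn0 // => b /negPf->.
by rewrite mul0n.
Qed.

(** The factor [b == d] collapses the double sum over the matrix to the column of [d]. *)
Lemma count_over_rival (d : C) i :
  count over_rival (vote_entries chic (mark m (enum_rank d)) (vote i)) =
  rank (O i) d.
Proof.
rewrite entriesE count_grid /rank card_set_sum; apply: eq_bigr => a _.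
rewrite -(sum_pick d (fun b => O i a b : nat)); apply: eq_bigr => b _.
by rewrite mulnb.
Qed.

Lemma count_not_under (d : C) i :
  count not_under (vote_entries chic (mark m (enum_rank d)) (vote i)) =
  #|[set b | ~~ O i c b]|.
Proof.
rewrite entriesE count_grid card_set_sum.
rewrite -(sum_pick c (fun a => \sum_b (~~ O i a b : nat))).
apply: eq_bigr => a _; rewrite big_distrr; apply: eq_bigr => b _.
by rewrite /= mulnb.
Qed.

Lemma has_over_pair (d : C) i :
  has over_pair (vote_entries chic (mark m (enum_rank d)) (vote i)) = O i c d.
Proof.
rewrite has_count entriesE count_grid.
have -> : \sum_a \sum_b (over_pair (a == c, b == d, O i a b) : nat) = O i c d.
  rewrite -(sum_pick c (fun a => O i a d : nat)).
  apply: eq_bigr => a _; rewrite -(sum_pick d (fun b => O i a b : nat)).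
  rewrite big_distrr.
  by apply: eq_bigr => b _; rewrite /= !mulnb.
by case: (O i c d).
Qed.

(** Links what the machine computes at index [enum_rank d] to the combinatorial condition. *)
Lemma rival_overtakesE d k :
  rival_overtakes m votes chic k (enum_rank d) = (d != c) && can_beat O c d k.
Proof.
rewrite /rival_overtakes (nth_map d) -?cardE ?ltn_ord // nth_enum_rank.
congr (_ && _); pose E i := vote_entries chic (mark m (enum_rank d)) (vote i).
have -> : [seq vote_entries chic (mark m (enum_rank d)) v | v <- votes] =
  map E (enum 'I_n) by rewrite /votes -map_comp.
have cardE' (p : pred (seq entry3)) :
    count p (map E (enum 'I_n)) = #|[set i | p (E i)]|.
  rewrite count_map card_set_sum -sum1_count big_mkcond big_enum /=.
  by apply: eq_bigr => i _; case: (p _).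
rewrite /overtakes !cardE' /can_beat /favorable /unfavorable /=.
rewrite /rival_fits /delayed /E /=.
by congr [&& _ < _, _ <= _ & _ < _]; apply: eq_card => i;
  rewrite !inE ?count_over_rival ?count_not_under ?has_over_pair.
Qed.

Lemma program_decides : 0 < n -> (forall i, partial_order (O i)) ->
  ~~ has (fun k => has (rival_overtakes m votes chic k) (iota 0 m)) (iota 1 m)
  <-> necessary_winner bucklin O c.
Proof.
move=> n_gt0 O_po; apply: iff_trans (iff_sym (can_beatP c n_gt0 O_po)).
split=> [/hasPn nobeat d k neq_dc k_range|nobeat].
  have /nobeat/hasPn/(_ (enum_rank d)) : k \in iota 1 m.
    by rewrite mem_iota add1n ltnS.
  rewrite mem_iota /= ltn_ord rival_overtakesE neq_dc; exact.
apply/hasPn => k; rewrite mem_iota add1n ltnS => k_range.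
apply/hasPn => j; rewrite mem_iota add0n => /andP[_ lt_j].
have -> : j = enum_rank (enum_val (Ordinal lt_j)) by rewrite enum_valK.
rewrite rival_overtakesE; case: eqP => //= /eqP neq_dc; exact: nobeat.
Qed.

End Encoding.

Theorem proposition5 :
  exists (M : machine) (p : {poly nat}),
    forall (C : finType) (c : C) (n : nat) (O : profile C n),
      0 < n ->
      (forall i : 'I_n, partial_order (O i)) ->
      exists b : bool,
        answers_within M (encode O c) (horner p (size (encode O c))) b /\
        (b <-> necessary_winner bucklin O c).
Proof.
(* The successor pays for the step that produces the verdict. *)
have [p timeE] := polynomial_succ polynomial_program_time.
(* A raised flag on [tR] means that some rival succeeds, so the machine accepts when it is down. *)
exists (compile 10 program tR (fun x => x != Some true)), p.
move=> C c n O n_gt0 O_po.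
rewrite -timeE encodeE; set chic := [seq a == c | a <- _].
set votes := [seq [seq [seq O i a b | b <- _] | a <- _] | i <- _].
have m_gt0 : 0 < #|C| by apply/card_gt0P; exists c.
have szC : size chic = #|C| by rewrite size_map -cardE.
have szV : all _ votes := size_votes O.
have [s run flag_s] := runs_program m_gt0 szC szV.
exists (cur (nth blank s tR) != Some true); split.
  apply: compile_answers; apply: runs_le run _; apply: program_time_mono.
  - by rewrite size_cat size_nseq leq_addr.
  (* Each vote contributes at least one bit because [C] contains [c]. *)
  - apply: leq_trans (_ : size (flatten (map flatten votes)) <= _).
      rewrite -(size_map flatten votes); apply: size_le_flatten.
      rewrite all_map; apply: sub_all szV => vote /andP[/eqP sz_vote].
      rewrite -sz_vote in m_gt0 *; case: vote m_gt0 {sz_vote} => //= row vote.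
      by move=> _ /andP[/eqP sz_row _]; rewrite size_cat sz_row.
    by rewrite size_cat /= size_cat; lia.
  by rewrite size_cat /= size_cat; lia.
rewrite flag_s cur_flag; apply: iff_trans (program_decides c n_gt0 O_po).
by case: (has _ _).
Qed.
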